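(* Let $\mathbb{X}=(X,\mathcal{M},\mu)$ be a nontrivial semifinite measure space with a collection of generators $\mathscr{G}$. If $\mathscr{G}$ is a Denjoy family, then there exist $k,K>0$ such that for every $G_0\in\mathscr{G}$, every $f\in\mathrm{BMO}_{\mathscr{G}}(\mathbb{X})$ with $\|f\|_{\mathrm{BMO}_{\mathscr{G}}(\mathbb{X})}=1$, and every $\alpha>1$, there is a countable pairwise disjoint collection $\{G_j\}_{j\in\mathcal{J}}\subset\mathscr{G}$ with doubles $G_j'$ satisfying (i) for almost every $x\in G_0\setminus\bigcup_{j\in\mathcal{J}}G_j'$, $|f(x)-f_{G_0}|\le k\alpha$; (ii) for every $j\in\mathcal{J}$, $|f_{G_j'}-f_{G_0}|\le k\alpha$; and (iii) $\sum_{j\in\mathcal{J}}\mu(G_j')\le\frac{K}{\alpha}\mu(G_0)$.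
   Context: Setting: $\mathbb{X}=(X,\mathcal{M},\mu)$ is a nontrivial (i.e. $\mu(X)>0$) semifinite measure space, $\mathcal{M}^*=\{E\in\mathcal{M}:0<\mu(E)<\infty\}$, and the collection of generators $\mathscr{G}\subset\mathcal{M}^*$ covers $X$. $L^1_{\mathrm{loc}}(\mathbb{X},\mathscr{G})$ is the space of measurable $f:X\to\mathbb{R}$ with $\int_G|f|\,d\mu<\infty$ for every $G\in\mathscr{G}$; $f_G=\frac1{\mu(G)}\int_G f\,d\mu$. $\mathrm{BMO}_{\mathscr{G}}(\mathbb{X})$ is the set of $f\in L^1_{\mathrm{loc}}(\mathbb{X},\mathscr{G})$ with $\|f\|_{\mathrm{BMO}_{\mathscr{G}}(\mathbb{X})}=\sup_{G\in\mathscr{G}}\frac1{\mu(G)}\int_G|f-f_G|\,d\mu<\infty$. Notation: $\mathscr{G}(x)=\{G\in\mathscr{G}:x\in G\}$. A sequence $\{G_n\}\subset\mathscr{G}(x)$ converges to $x$, written $G_n\to x$, if $\mu(G_n)\to0$. Also $\limsup_{G\to x}\frac1{\mu(G)}\int_G|f|\,d\mu:=\lim_{\varepsilon\to0}\sup\{\frac1{\mu(G)}\int_G|f|\,d\mu: G\in\mathscr{G}(x),\ \mu(G)<\varepsilon\}$. The outer measure is $\mu^*(A)=\inf\{\mu(E):A\subset E\in\mathcal{M}\}$. For $a>1$ and $A\subset X$, $\Omega_a(A)=\bigcup\{G\in\mathscr{G}:G\cap A\ne\emptyset,\ \mu(G)\le a\mu^*(A)\}$, and $\Omega_a^{(j)}$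 is the $j$-th iterate of $\Omega_a$. For $1<a\le b$, a generator $G'\in\mathscr{G}$ is an $(a,b)$-Denjoy double of $G\in\mathscr{G}$ if $\Omega_a(G)\subset G'$ and $\mu(G')\le b\mu(G)$. $\mathscr{G}$ is a Denjoy family if: - (Shrinking) for almost every $x\in X$ there is a sequence $\{G_n\}\subset\mathscr{G}(x)$ with $G_n\to x$; - (Denjoy doubling) there are uniform constants $1<a\le b$ such that every $G\in\mathscr{G}$ has an $(a,b)$-Denjoy double; - (Growth) for any $G_0,G\in\mathscr{G}$ with $G\cap G_0\ne\emptyset$ there is $j\in\mathbb{N}$ with $\mu^*(\Omega_a^{(j)}(G))\ge\frac ab\mu(G_0)$; - (Weak differentiation) for every $f\in L^1_{\mathrm{loc}}(\mathbb{X},\mathscr{G})$, for almost every $x\in X$, $|f(x)|\le\limsup_{G\to x}\frac1{\mu(G)}\int_G|f|\,d\mu$. With $a,b$ the constants of the Denjoy doubling property, ''double'' means $(a,b)$-Denjoy double; $G_j'$ denotes a double of $G_j$. *)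

(* Defs.v *)
From HB Require Import structures.
From mathcomp Require Import all_boot all_order all_algebra.
From mathcomp Require Import all_classical all_reals all_analysis.

Set Implicit Arguments.
Unset Strict Implicit.
Unset Printing Implicit Defensive.

Import Order.TTheory GRing.Theory Num.Theory.
Import numFieldNormedType.Exports.

Local Open Scope classical_set_scope.
Local Open Scope ring_scope.
Local Open Scope ereal_scope.

Section denjoy.
Context (d : measure_display) (T : measurableType d) (R : realType).
Variable mu : {measure set T -> \bar R}.

Definition semifinite := forall E : set T, measurable E -> mu E = +oo ->
  exists F : set T, [/\ measurable F, F `<=` E, 0 < mu F & mu F < +oo].

(* The library's [mu_ext mu] takes the infimum over countable covers instead. *)
Definition outer_mu (A : set T) : \bar R :=
  ereal_inf [set mu E | E in [set E : set T | measurable E /\ A `<=` E]].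

Variable GG : set (set T).

Definition generators :=
  (forall G, GG G -> [/\ measurable G, 0 < mu G & mu G < +oo]) /\
  \bigcup_(G in GG) G = setT.

Definition GG_at (x : T) : set (set T) := [set G | GG G /\ G x].

Definition L1loc (f : T -> R) :=
  measurable_fun setT f /\
  forall G, GG G -> \int[mu]_(x in G) `|f x|%:E < +oo.

Definition mean (f : T -> R) (G : set T) : R :=
  ((fine (mu G))^-1 * \int[mu]_(x in G) f x)%R.

Definition abs_mean (f : T -> R) (G : set T) : \bar R :=
  (mu G)^-1 * \int[mu]_(x in G) `|f x|%:E.

Definition BMO_norm (f : T -> R) : \bar R :=
  ereal_sup [set abs_mean (fun x => f x - mean f G)%R G | G in GG].

Definition BMO (f : T -> R) := L1loc f /\ BMO_norm f < +oo.

(* For small [eps] the set below may be empty, in which case its supremum in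
   [\bar R] is [-oo]; under [shrinking] this happens only for a null set of
   points [x]. *)
Definition limsup_mean (f : T -> R) (x : T) : \bar R :=
  lim (ereal_sup [set abs_mean f G | G in [set G | GG_at x G /\ mu G < eps%:E]]
       @[eps --> (0%R : R)^'+]).

Definition Omega (a : R) (A : set T) : set T :=
  \bigcup_(G in [set G | [/\ GG G, G `&` A !=set0 &
                             mu G <= a%:E * outer_mu A]]) G.

Definition denjoy_double (a b : R) (G G' : set T) :=
  [/\ GG G', Omega a G `<=` G' & mu G' <= b%:E * mu G].

Definition shrinking := \forall x \ae mu,
  exists2 G_ : nat -> set T,
    forall n, GG_at x (G_ n) & (fun n => mu (G_ n)) @ \oo --> 0.

Definition denjoy_doubling (a b : R) :=
  forall G, GG G -> exists G', denjoy_double a b G G'.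

Definition growth (a b : R) :=
  forall G0 G, GG G0 -> GG G -> G `&` G0 !=set0 ->
    exists j : nat, (a / b)%:E * mu G0 <= outer_mu (iter j (Omega a) G).

Definition weak_differentiation := forall f : T -> R, L1loc f ->
  \forall x \ae mu, `|f x|%:E <= limsup_mean f x.

(* A family is Denjoy when this holds for some [a] and [b]; they are kept as
   parameters because "double" always refers to these constants. *)
Definition denjoy_family (a b : R) :=
  [/\ (1 < a <= b)%R, shrinking, denjoy_doubling a b, growth a b
    & weak_differentiation].

End denjoy.

(* Main.v *)
Require Import Defs.
From HB Require Import structures.
From mathcomp Require Import all_boot all_order all_algebra.
From mathcomp Require Import all_classical all_reals all_analysis.
From mathcomp Require Import measurable_realfun ring.

Import Order.TTheory GRing.Theory Num.Theory.
Import numFieldNormedType.Exports.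

Local Open Scope classical_set_scope.
Local Open Scope ring_scope.
Local Open Scope ereal_scope.

(** This is a Calderon-Zygmund decomposition at height [k * alpha] in which
    doubles of generators replace the dilated balls.  Put [h := f - f_G0], fix a
    double [D G] of every generator [G], and let [k := (1 + b) * b ^+ 2].  Since
    [G0] and [D G0] have comparable measure, the norm bound controls the integral
    of [|h|] over [D G0] by [(1 + b) * b * mu G0].

    Call a generator bad when its mean of [|h|] exceeds [k * alpha].  By the
    bound above, a generator contained in [D G0] of measure at least
    [(a / b) * mu G0] is never bad.  If a smaller bad generator [G] meets [G0],
    its successive doubles [G], [D G], [D (D G)], ... stay inside [D G0] while
    they are small and, by growth, do not stay small forever; so badness stops
    along the way, at some bad [A] whose double is not bad
    ([stopping_double]).  Let [C] collect these stopping generators.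

    A greedy selection ([vitali_selection]) extracts from [C] disjoint [G j]
    such that every [A] in [C] meets some [G j] with [mu A <= a * mu (G j)].  By
    the definition of a double such an [A] lies in [D (G j)].  The three claims
    follow.  A point of [G0] outside all the [D (G j)] lies in no small bad
    generator, so weak differentiation bounds [|h|] there.  The double of [G j]
    is not bad, which bounds its mean.  Finally [G j] is bad, so the measures
    [mu (G j)] sum, by disjointness, to at most the integral of [|h|] over
    [D G0] divided by [k * alpha]; passing to the doubles costs a factor [b], and
    the value of [k] makes the resulting constant [K] equal to [1]. *)

(** * Greedy selection of disjoint sets *)

Section Selection.
Set Implicit Arguments.
Unset Strict Implicit.
Context {d : measure_display} {T : measurableType d} {R : realType}.
Context (mu : {measure set T -> \bar R}).

(** The supremum [s] of the measures is positive and finite, so [s / a < s] is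
    exceeded.  The empty set encodes that there is nothing to pick, which keeps
    the greedy recursion below total. *)
Lemma near_maximal_pick (C : set (set T)) (B : set T) (a : R) :
    (1 < a)%R -> measurable B -> mu B < +oo ->
    (forall A, C A -> [/\ measurable A, 0 < mu A & A `<=` B]) ->
  exists A, (A !=set0 -> C A) /\
    forall A', C A' -> mu A' <= a%:E * mu A.
Proof.
move=> a1 mB Bfin CB; have a0 : (0 < a)%R by exact: lt_trans a1.
have [[A0 CA0]|noC] := pselect (exists A, C A); last first.
  exists set0; split=> [[x]//|A' CA'].
  by exfalso; apply: noC; exists A'.
pose s := ereal_sup [set mu A | A in C].
have s_ge A : C A -> mu A <= s by move=> CA; apply: ereal_sup_ubound; exists A.
have s0 : 0 < s by have [_ A00 _] := CB _ CA0; exact: lt_le_trans (s_ge _ CA0).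
have sB : s <= mu B.
  apply: ge_ereal_sup => _ [A CA <-]; have [mA _ AB] := CB _ CA.
  by apply: le_measure; rewrite ?inE.
have sfin : s \is a fin_num.
  by rewrite ge0_fin_numE ?(ltW s0)//; exact: le_lt_trans Bfin.
have : (a^-1)%:E * s < s.
  rewrite -(fineK sfin) -EFinM lte_fin gtr_pMl ?invf_lt1//.
  by rewrite -lte_fin fineK.
move=> /ereal_sup_gt[_ [A CA <-] sA].
exists A; split=> // A' CA'; apply: le_trans (s_ge _ CA') _.
by rewrite -lee_pdivrMl// ltW.
Qed.

(** Pick at each step a set, disjoint from the previous ones, of nearly maximal
    measure.  A set [A] of [C] must meet some pick, for otherwise every pick would
    have measure at least [mu A / a], too much for disjoint subsets of [B]; the
    first pick that it meets was chosen while [A] was still available, hence has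
    measure at least [mu A / a]. *)
Lemma vitali_selection (C : set (set T)) (B : set T) (a : R) :
    (1 < a)%R -> measurable B -> mu B < +oo ->
    (forall A, C A -> [/\ measurable A, 0 < mu A & A `<=` B]) ->
  exists G : nat -> set T,
    [/\ forall j, G j !=set0 -> C (G j),
        trivIset setT G &
        forall A, C A -> exists2 j, A `&` G j !=set0 & mu A <= a%:E * mu (G j)].
Proof.
move=> a1 mB Bfin CB; have a0 : (0 < a)%R by exact: lt_trans a1.
have pickP U : exists A,
    (A !=set0 -> C A /\ A `&` U = set0) /\
    forall A', C A' -> A' `&` U = set0 -> mu A' <= a%:E * mu A.
  have CU A : [set A | C A /\ A `&` U = set0] A ->
      [/\ measurable A, 0 < mu A & A `<=` B] by move=> [/CB].
  have [A [CA maxA]] := near_maximal_pick a1 mB Bfin CU.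
  by exists A; split=> // A' CA' A'U; exact: maxA.
have [pick pickE] := choice pickP.
pose U n := iter n (fun V => V `|` pick V) set0.
pose G n := pick (U n).
have GU n : G n `&` U n = set0.
  have [|/set0P/negP/negPn/eqP ->] := pselect (G n !=set0); last by rewrite set0I.
  by move=> /(pickE (U n)).1[].
have subU m n : (m < n)%N -> G m `<=` U n.
  elim: n => // n IH; rewrite ltnS leq_eqVlt => /predU1P[->|mn] x Gx; first by right.
  by left; exact: IH.
have tG : trivIset setT G.
  apply: ltn_trivIset => n m mn; rewrite -subset0 -(GU n) => x [Gm Gn].
  by split=> //; exact: subU mn _ Gm.
have GC j : G j !=set0 -> C (G j) by move=> /(pickE (U j)).1[].
have G_B j : measurable (G j) /\ G j `<=` B.
  have [/GC/CB[]//|/set0P/negP/negPn/eqP ->] := pselect (G j !=set0).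
  by split.
exists G; split => // A CA; apply: contrapT => noj.
have AU n : A `&` U n = set0.
  elim: n => [|n IH]; first by rewrite setI0.
  rewrite /U iterS -/(U n) setIUr IH set0U.
  apply/eqP; apply: contrapT => /negP/set0P AG; apply: noj.
  by exists n => //; exact: (pickE (U n)).2.
have AG n : mu A <= a%:E * mu (G n) by exact: (pickE (U n)).2.
have [mA A0 AB] := CB _ CA.
have Afin : mu A \is a fin_num.
  rewrite ge0_fin_numE//; apply: le_lt_trans Bfin.
  by apply: le_measure; rewrite ?inE.
have Bfin' : mu B \is a fin_num by rewrite ge0_fin_numE.
have bound n : n%:R%:E * ((a^-1)%:E * mu A) <= mu B.
  have -> : n%:R%:E * ((a^-1)%:E * mu A) = \sum_(i < n) ((a^-1)%:E * mu A).
    by rewrite sumr_const card_ord mule_natl.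
  apply: le_trans (_ : \sum_(i < n) mu (G i) <= _).
    by apply: lee_sum => i _; rewrite lee_pdivrMl.
  rewrite -measure_bigsetU//; last by move=> i; have [] := G_B i.
  apply: le_measure; rewrite ?inE//.
    by apply: bigsetU_measurable => i _; have [] := G_B i.
  by rewrite -bigcup_mkord; apply: bigcup_sub => i _; have [] := G_B i.
pose t := (a^-1 * fine (mu A))%R.
have t0 : (0 < t)%R by rewrite mulr_gt0 ?invr_gt0// -lte_fin fineK.
have := bound (Num.bound (fine (mu B) / t)).
rewrite -(fineK Afin) -(fineK Bfin') -!EFinM lee_fin -/t -ler_pdivlMr//.
by rewrite leNgt archi_boundP// divr_ge0// ?fine_ge0// ltW.
Qed.

End Selection.

(** * Averages *)

Section Averages.
Set Implicit Arguments.
Unset Strict Implicit.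
Context {d : measure_display} {T : measurableType d} {R : realType}.
Context (mu : {measure set T -> \bar R}).

(** Comparisons of averages are carried out in this product form, which avoids
    inverses in the extended reals. *)
Lemma abs_mean_le_fin (f : T -> R) (G : set T) (c : R) :
    0 < mu G -> mu G < +oo ->
  (abs_mean mu f G <= c%:E) = (\int[mu]_(x in G) `|f x|%:E <= c%:E * mu G).
Proof.
move=> G0 Gfin; have Gnum : mu G \is a fin_num by rewrite ge0_fin_numE.
have g0 : (0 < fine (mu G))%R by rewrite -lte_fin fineK.
by rewrite /abs_mean -(fineK Gnum) inver (gt_eqF g0) lee_pdivrMl// muleC.
Qed.

Lemma integrable_fin_cst (G : set T) (c : R) :
  measurable G -> mu G < +oo -> mu.-integrable G (EFin \o cst c).
Proof.
move=> mG Gfin; apply/integrableP; split; first exact/measurable_EFinP.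
by rewrite (integral_cst mu mG `|c|%:E) lte_mul_pinfty.
Qed.

Lemma mean_dist_le (f : T -> R) (G : set T) (c : R) :
    measurable G -> 0 < mu G -> mu G < +oo -> mu.-integrable G (EFin \o f) ->
  `|mean mu f G - c|%:E * mu G <= \int[mu]_(x in G) `|(f x - c)%R|%:E.
Proof.
move=> mG G0 Gfin If; have Gnum : mu G \is a fin_num by rewrite ge0_fin_numE.
have g0 : (0 < fine (mu G))%R by rewrite -lte_fin fineK.
have Ic := integrable_fin_cst c mG Gfin.
have Ifc : mu.-integrable G (EFin \o (fun x => f x - c)%R).
  by have := integrableB mG If Ic; apply: eq_integrable.
have := le_normr_Rintegral mG Ifc.
rewrite RintegralB// Rintegral_cst// -lee_fin /Rintegral fineK; last first.
  exact: (integrable_fin_num mG (integrable_norm Ifc)).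
apply: le_trans; rewrite -[X in _ * X](fineK Gnum) -EFinM lee_fin.
rewrite -{1}(gtr0_norm g0) -normrM mulrBl /mean /Rintegral mulrAC mulVf ?gt_eqF//.
by rewrite mul1r.
Qed.

Lemma integral_dist_shift (f : T -> R) (G : set T) (c c' : R) :
    measurable G -> measurable_fun setT f ->
  \int[mu]_(x in G) `|(f x - c)%R|%:E <=
  \int[mu]_(x in G) `|(f x - c')%R|%:E + `|c - c'|%:E * mu G.
Proof.
move=> mG mf.
have mfc r : measurable_fun G (fun x => `|(f x - r)%R|%:E).
  apply/measurable_EFinP; apply: measurableT_comp => //.
  apply: measurable_funB => //; exact: measurable_funTS.
rewrite -integral_cst// -ge0_integralD//; last by move=> x _; rewrite /cst lee_fin.
apply: ge0_le_integral => //; first by apply: emeasurable_funD.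
by move=> x _; rewrite lee_fin (distrC c c') ler_distD.
Qed.

(** The suprema defining the limit superior are monotone in the threshold, so
    their limit exists; without this [lim] would say nothing. *)
Lemma limsup_mean_le (GG : set (set T)) (f : T -> R) (x : T) (e c : R) :
    (0 < e)%R ->
    (forall G, GG_at GG x G -> mu G < e%:E -> abs_mean mu f G <= c%:E) ->
  limsup_mean mu GG f x <= c%:E.
Proof.
move=> e0 small; apply: lime_le.
  apply: nondecreasing_at_right_is_cvge; near=> y => u v _ _ uv.
  apply: le_ereal_sup => _ [G [Gx Gu] <-]; exists G => //; split=> //.
  by apply: lt_le_trans Gu _; rewrite lee_fin.
near=> t; apply: ge_ereal_sup => _ [G [Gx Gt] <-]; apply: small => //.
apply: lt_trans Gt _; rewrite lte_fin.
by near: t; exact: nbhs_right_lt.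
Unshelve. all: by end_near. Qed.

End Averages.

(** * Doubles of generators *)

Section Doubling.
Set Implicit Arguments.
Unset Strict Implicit.
Context {d : measure_display} {T : measurableType d} {R : realType}.
Context (mu : {measure set T -> \bar R}) (GG : set (set T)).
Context (a b : R) (a1 : (1 < a)%R) (ab : (a <= b)%R).

Lemma outer_muS (A B : set T) : A `<=` B -> outer_mu mu A <= outer_mu mu B.
Proof.
move=> AB; apply: le_ereal_inf => _ [E [mE BE] <-]; exists E => //.
by split=> //; exact: subset_trans BE.
Qed.

Lemma outer_mu_measurable (A : set T) : measurable A -> outer_mu mu A = mu A.
Proof.
move=> mA; apply/eqP; rewrite eq_le; apply/andP; split.
  by apply: ereal_inf_lbound; exists A => //; split.
by apply: le_ereal_inf_tmp => _ [E [mE AE] <-]; apply: le_measure; rewrite ?inE.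
Qed.

Lemma OmegaS (A B : set T) : A `<=` B -> Omega mu GG a A `<=` Omega mu GG a B.
Proof.
move=> AB x [G [GGG [y [Gy Ay]] GA] Gx]; exists G => //; split=> //.
  by exists y; split=> //; exact: AB.
apply: le_trans GA _; apply: lee_wpmul2l; last exact: outer_muS.
by rewrite lee_fin ltW// (lt_trans ltr01).
Qed.

Hypothesis genGG : forall G, GG G -> [/\ measurable G, 0 < mu G & mu G < +oo].

Lemma sub_Omega (G A : set T) : GG G -> GG A -> A `&` G !=set0 ->
  mu A <= a%:E * mu G -> A `<=` Omega mu GG a G.
Proof.
move=> GGG GA AG muA x Ax; exists A => //; split=> //.
by rewrite outer_mu_measurable//; have [] := genGG GGG.
Qed.

Variable D : set T -> set T.
Hypothesis DP : forall G, GG G -> denjoy_double mu GG a b G (D G).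

Lemma sub_double (G : set T) : GG G -> G `<=` D G.
Proof.
move=> GGG; have [_ OD _] := DP GGG; have [mG G0 Gfin] := genGG GGG.
apply: subset_trans OD; apply: sub_Omega => //.
  by rewrite setIid; apply/set0P; apply: contraTneq G0 => ->; rewrite measure0 ltxx.
by rewrite lee_pemull// lee_fin ltW.
Qed.

Lemma sub_double_meet (G A : set T) : GG G -> GG A -> A `&` G !=set0 ->
  mu A <= a%:E * mu G -> A `<=` D G.
Proof.
move=> GGG GA AG muA; have [_ OD _] := DP GGG.
by apply: subset_trans OD; exact: sub_Omega.
Qed.

Lemma iter_double_GG (G : set T) j : GG G -> GG (iter j D G).
Proof. by move=> GGG; elim: j => //= j IH; have [] := DP IH. Qed.

Lemma iter_Omega_double (G : set T) j : GG G ->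
  iter j (Omega mu GG a) G `<=` iter j D G.
Proof.
move=> GGG; elim: j => //= j IH.
have [_ OD _] := DP (iter_double_GG j GGG).
exact: subset_trans (OmegaS IH) OD.
Qed.

(** The threshold [a / b] is chosen for this: doubling multiplies the measure by
    at most [b], so [D A] still has measure at most [a * mu G0] and is one of the
    sets that make up [Omega a G0]. *)
Lemma double_small_sub (G0 A : set T) : GG G0 -> GG A -> A `&` G0 !=set0 ->
  mu A < (a / b)%:E * mu G0 -> D A `<=` D G0.
Proof.
move=> GG0 GA [x [Ax G0x]] Asmall; have [GDA _ DAb] := DP GA.
apply: sub_double_meet => //.
  by exists x; split=> //; exact: sub_double Ax.
have b0 : (0 < b)%R by rewrite (lt_le_trans _ ab)// (lt_trans ltr01).
apply: le_trans DAb _; rewrite -lee_pdivlMl// muleA -EFinM mulrC.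
exact: ltW.
Qed.

(** Otherwise [P] and smallness would pass from each iterated double of [G] to
    the next: the next one satisfies [P], lies in [D G0], and so is small by the
    assumption on large sets.  But the iterated doubles contain the iterates of
    [Omega], whose measures growth forbids to stay small. *)
Lemma stopping_double (G0 G : set T) (P : set T -> Prop) :
    growth mu GG a b -> GG G0 ->
    (forall A, GG A -> A `<=` D G0 -> (a / b)%:E * mu G0 <= mu A -> ~ P A) ->
    GG G -> G `&` G0 !=set0 -> mu G < (a / b)%:E * mu G0 -> P G ->
  exists A, [/\ GG A, G `<=` A, mu A < (a / b)%:E * mu G0, P A & ~ P (D A)].
Proof.
move=> gr GG0 large GGG [x [Gx G0x]] Gsmall PG; apply: contrapT => noA.
have all_small j : [/\ G `<=` iter j D G, mu (iter j D G) < (a / b)%:E * mu G0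
    & P (iter j D G)].
  elim: j => [|j [sub small Pj]]; first by split.
  have GGj := iter_double_GG j GGG.
  have jG0 : iter j D G `&` G0 !=set0 by exists x; split=> //; exact: sub.
  have Pj1 : P (iter j.+1 D G).
    by apply: contrapT => nP; apply: noA; exists (iter j D G).
  split=> //; first exact: subset_trans sub (sub_double GGj).
  rewrite ltNge; apply/negP => big; apply: large big Pj1.
    exact: (iter_double_GG j.+1 GGG).
  exact: double_small_sub.
have GG0ne : G `&` G0 !=set0 by exists x.
have [j jbig] := gr _ _ GG0 GGG GG0ne.
have [_ + _] := all_small j; rewrite ltNge => /negP; apply.
have [mj _ _] := genGG (iter_double_GG j GGG).
apply: le_trans jbig _; rewrite -(outer_mu_measurable mj).
by apply: outer_muS; exact: iter_Omega_double.
Qed.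

End Doubling.

(** * Functions of unit BMO norm *)

Section UnitBMO.
Set Implicit Arguments.
Unset Strict Implicit.
Context {d : measure_display} {T : measurableType d} {R : realType}.
Context (mu : {measure set T -> \bar R}) (GG : set (set T)).
Hypothesis genGG : forall G, GG G -> [/\ measurable G, 0 < mu G & mu G < +oo].
Variable f : T -> R.
Hypothesis f_loc : L1loc mu GG f.

Lemma L1loc_integrable (G : set T) : GG G -> mu.-integrable G (EFin \o f).
Proof.
move=> GGG; have [mf ffin] := f_loc.
apply/integrableP; split; last exact: ffin.
by apply/measurable_EFinP; exact: measurable_funTS.
Qed.

Lemma L1loc_shift (c : R) : L1loc mu GG (fun x => f x - c)%R.
Proof.
have [mf ffin] := f_loc; split; first exact: measurable_funB.
move=> G GGG; have [mG _ Gfin] := genGG GGG.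
apply: le_lt_trans (integral_dist_shift mu c 0 mG mf) _.
have -> : \int[mu]_(x in G) `|(f x - 0)%R|%:E = \int[mu]_(x in G) `|f x|%:E.
  by apply: eq_integral => x _; rewrite subr0.
by rewrite lte_add_pinfty// ?ffin// lte_mul_pinfty.
Qed.

Hypothesis f_norm : BMO_norm mu GG f = 1.

Lemma oscillation_le (G : set T) : GG G ->
  \int[mu]_(x in G) `|(f x - mean mu f G)%R|%:E <= mu G.
Proof.
move=> GGG; have [mG G0 Gfin] := genGG GGG.
rewrite -[leRHS]mul1e -abs_mean_le_fin// -f_norm.
by apply: ereal_sup_ubound; exists G.
Qed.

(** The oscillation over the larger set bounds the integral over the smaller
    one, at the cost of the ratio of the measures. *)
Lemma nested_mean_dist (G G' : set T) (r : R) : GG G -> GG G' -> G `<=` G' ->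
  mu G' <= r%:E * mu G -> (`|mean mu f G - mean mu f G'| <= r)%R.
Proof.
move=> GGG GGG' GG' muG'; have [mG G0 Gfin] := genGG GGG.
have [mG' _ _] := genGG GGG'; have [mf _] := f_loc.
have Gnum : mu G \is a fin_num by rewrite ge0_fin_numE.
have := mean_dist_le (mean mu f G') mG G0 Gfin (L1loc_integrable GGG).
move=> /le_trans dist; rewrite -lee_fin -(lee_pmul2r Gnum G0).
apply: le_trans muG'; apply: le_trans (oscillation_le GGG').
apply: dist; apply: ge0_subset_integral => //.
apply/measurable_EFinP; apply: measurableT_comp => //.
by apply: measurable_funB => //; exact: measurable_funTS.
Qed.

End UnitBMO.

(** * The decomposition *)

Theorem lemma5p4 (d : measure_display) (T : measurableType d) (R : realType)
  (mu : {measure set T -> \bar R}) (GG : set (set T)) (a b : R)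
  (mu_nontrivial : 0 < mu setT) (mu_semifinite : semifinite mu)
  (GG_generators : generators mu GG)
  (GG_denjoy : denjoy_family mu GG a b) :
  exists k K : R, [/\ (0 < k)%R, (0 < K)%R &
    forall (G0 : set T) (f : T -> R) (alpha : R),
      GG G0 -> BMO mu GG f -> BMO_norm mu GG f = 1 -> (1 < alpha)%R ->
      exists (J : set nat) (G G' : nat -> set T),
        [/\ forall j, J j -> GG (G j) /\ denjoy_double mu GG a b (G j) (G' j),
            trivIset J G,
            \forall x \ae mu, (G0 `\` \bigcup_(j in J) G' j) x ->
              (`|f x - mean mu f G0| <= k * alpha)%R,
            forall j, J j ->
              (`|mean mu f (G' j) - mean mu f G0| <= k * alpha)%R
          & \esum_(j in J) mu (G' j) <= (K / alpha)%:E * mu G0]].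
Proof.
have [genGG _] := GG_generators.
have [/andP[a1 ab] _ doubling gr wdiff] := GG_denjoy.
have a0 : (0 < a)%R by exact: lt_trans a1.
have b0 : (0 < b)%R by exact: lt_le_trans ab.
have D_ G : exists G', GG G -> denjoy_double mu GG a b G G'.
  have [/doubling[G' GG']|nG] := pselect (GG G); first by exists G'.
  by exists set0.
have [D DP] := choice D_.
pose k := ((1 + b) * b ^+ 2)%R; exists k, 1%R.
have k0 : (0 < k)%R by rewrite mulr_gt0 ?exprn_gt0 ?addr_gt0.
split=> // G0 f alpha GG0 [f_loc _] f_norm alpha1.
have alpha0 : (0 < alpha)%R by exact: lt_trans alpha1.
have ka0 : (0 < k * alpha)%R by rewrite mulr_gt0.
have [mG0 G0pos G0fin] := genGG _ GG0; have [mf _] := f_loc.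
pose h x := (f x - mean mu f G0)%R.
have h_loc : L1loc mu GG h := L1loc_shift genGG f_loc (mean mu f G0).
have mh : measurable_fun setT (fun x => `|h x|%:E).
  by have [mh _] := h_loc; apply/measurable_EFinP; apply: measurableT_comp.
have GDG0 := sub_double a1 genGG DP GG0; have [GGD _ D0b] := DP _ GG0.
have [mD Dpos Dfin] := genGG _ GGD.
have hD : \int[mu]_(x in D G0) `|h x|%:E <= ((1 + b) * b)%:E * mu G0.
  apply: le_trans (_ : (1 + b)%:E * mu (D G0) <= _); last first.
    by rewrite EFinM -muleA lee_wpmul2l// lee_fin addr_ge0 ?ltW.
  apply: le_trans (integral_dist_shift mu _ (mean mu f (D G0)) mD mf) _.
  rewrite EFinD ge0_muleDl ?mul1e ?lee_fin ?(ltW b0)//.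
  apply: leeD; first exact: (oscillation_le genGG f_norm GGD).
  apply: lee_wpmul2r => //.
  by rewrite lee_fin; apply: (nested_mean_dist genGG f_loc f_norm).
have large A : GG A -> A `<=` D G0 -> (a / b)%:E * mu G0 <= mu A ->
    ~ (k * alpha)%:E < abs_mean mu h A.
  move=> GA AD Abig; apply/negP; rewrite -leNgt.
  have [mA Apos Afin] := genGG _ GA; rewrite abs_mean_le_fin//.
  apply: le_trans (_ : \int[mu]_(x in D G0) `|h x|%:E <= _).
    by apply: ge0_subset_integral => //; exact: measurable_funTS.
  apply: le_trans hD _.
  apply: le_trans (_ : (k * alpha)%:E * ((a / b)%:E * mu G0) <= _); last first.
    by apply: lee_wpmul2l => //; rewrite lee_fin ltW.
  rewrite muleA -EFinM; apply: lee_wpmul2r => //; rewrite lee_fin.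
  (* [k] carries one factor [b] more than the bound on the integral, to absorb
     the factor [a / b]; [alpha * a > 1] does the rest. *)
  have -> : (k * alpha * (a / b) = (1 + b) * b * (alpha * a))%R.
    by rewrite /k; field; rewrite gt_eqF.
  by rewrite ler_peMr ?mulr_ge0 ?addr_ge0 ?ltW// mulr_egt1.
(* [C] is the family of stopping generators. *)
pose C := [set A | [/\ GG A, A `&` G0 !=set0, mu A < (a / b)%:E * mu G0,
  (k * alpha)%:E < abs_mean mu h A & abs_mean mu h (D A) <= (k * alpha)%:E]].
have C_B A : C A -> [/\ measurable A, 0 < mu A & A `<=` D G0].
  move=> [GA AG0 Asmall _ _]; have [mA Apos _] := genGG _ GA; split=> //.
  apply: subset_trans (sub_double a1 genGG DP GA) _.
  exact: (double_small_sub a1 ab genGG DP GG0 GA AG0 Asmall).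
have [G [GC tG cover]] := vitali_selection a1 mD Dfin C_B.
(* The selection marks its idle steps by the empty set. *)
pose J := [set j | G j !=set0]; exists J, G, (D \o G).
have GGj j : J j -> GG (G j) by move=> /GC[].
split.
- by move=> j /GGj GGGj; split=> //; exact: DP.
- exact: sub_trivIset tG.
- apply: filterS (wdiff _ h_loc) => x hx [G0x xG].
  rewrite -lee_fin; apply: le_trans hx _.
  have e0 : (0 < a / b * fine (mu G0))%R.
    by rewrite mulr_gt0 ?divr_gt0// fine_gt0// G0pos.
  apply: (limsup_mean_le e0) => H [GH Hx]; rewrite EFinM fineK ?ge0_fin_numE//.
  move=> Hsmall; rewrite leNgt; apply/negP => Hbad.
  have HG0 : H `&` G0 !=set0 by exists x.
  have [A [GA HA Asmall Abad /negP]] :=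
    stopping_double a1 ab genGG DP gr GG0 large GH HG0 Hsmall Hbad.
  rewrite -leNgt => DAgood.
  have CA : C A by split=> //; exists x; split=> //; exact: HA.
  have [j AGj muA] := cover _ CA; apply: xG.
  have Jj : J j by have [y []] := AGj; exists y.
  exists j => //=; apply: (sub_double_meet genGG DP (GGj _ Jj) GA AGj muA).
  exact: HA.
- move=> j Jj; have [GGGj _ _ _ good] := GC _ Jj; have [GD _ _] := DP _ GGGj.
  have [mDj Dj0 Djfin] := genGG _ GD; have Djnum : mu (D (G j)) \is a fin_num.
    by rewrite ge0_fin_numE.
  rewrite -lee_fin -(lee_pmul2r Djnum Dj0).
  apply: le_trans (mean_dist_le _ mDj Dj0 Djfin (L1loc_integrable f_loc GD)) _.
  by rewrite -abs_mean_le_fin.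
- pose c := (b / (k * alpha))%R.
  have c0 : (0 <= c)%R by rewrite divr_ge0 ?ltW.
  pose I j := \int[mu]_(x in G j) `|h x|%:E.
  have I0 j : 0 <= I j by exact: integral_ge0.
  have mG j : measurable (G j) /\ G j `<=` D G0.
    have [/GC/C_B[]//|/set0P/negP/negPn/eqP ->] := pselect (G j !=set0).
    by split.
  have DjI j : J j -> mu ((D \o G) j) <= c%:E * I j.
    move=> Jj; have [GGGj _ _ bad _] := GC _ Jj; have [_ _ Db] := DP _ GGGj.
    have [_ Gj0 Gjfin] := genGG _ GGGj.
    move: bad; rewrite ltNge abs_mean_le_fin// -ltNge => bad.
    apply: le_trans Db _; rewrite /c EFinM -muleA.
    apply: lee_wpmul2l; first by rewrite lee_fin ltW.
    by rewrite lee_pdivlMl// ltW.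
  apply: le_trans (le_esum DjI) _.
  apply: le_trans (_ : \esum_(j in setT) (c%:E * I j) <= _).
    rewrite [leLHS]esum_mkcond; apply: le_esum => j _.
    by case: ifP => //; rewrite mule_ge0.
  rewrite -nneseries_esumT; last by move=> j; rewrite mule_ge0.
  rewrite nneseriesZl// -ge0_integral_bigcup//; last 2 first.
    by move=> j; have [] := mG j.
    exact: measurable_funTS.
  apply: le_trans (_ : c%:E * (((1 + b) * b)%:E * mu G0) <= _).
    apply: lee_wpmul2l => //; apply: le_trans hD.
    apply: ge0_subset_integral => //.
    + by apply: bigcup_measurable => j _; have [] := mG j.
    + exact: measurable_funTS.
    + by apply: bigcup_sub => j _; have [] := mG j.
  rewrite muleA -EFinM; apply: lee_wpmul2r => //.
  rewrite lee_fin /c /k le_eqVlt; apply/orP; left; apply/eqP; field.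
  by rewrite !gt_eqF// addr_gt0.
Qed.
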